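(* Let $k$ be an integer, and let $G$ be a graph of order $n$. (1) If $\delta(G)\geq k\geq 0$, $n\geq 2k+2$ and $\rho(\overline{G})\leq \rho(\overline{\underline{L}_n^k})$, then $G$ is traceable unless $G=\underline{L}_n^k$, or $n=2k+2$ and $G\in \mathcal{H}_n$. (2) If $\delta(G)\geq k\geq 1$, $n\geq 2k+1$ and $\rho(\overline{G})\leq\rho(\overline{L^k_n})$, then $G$ is Hamiltonian unless $G=L_n^k$, or $n=2k+1$ and $G\in\mathcal{H}_n$.
   Context: All graphs are finite and simple; equality of graphs and membership in classes of graphs are up to isomorphism. $\overline{G}$ is the complement of $G$, $\delta(G)$ the minimum degree, and $\rho(G)$ the spectral radius, i.e. the largest eigenvalue of the adjacency matrix. A graph is Hamiltonian (traceable) if it contains a cycle (path) through all its vertices. $G_1+G_2$ denotes the disjoint union of graphs, $kG$ the disjoint union of $k$ copies of $G$, and $G_1\vee G_2$ the join (the disjoint union together with all edges between $V(G_1)$ and $V(G_2)$). For $1\leq k\leq (n-1)/2$, $L_n^k=K_1\vee(K_k+K_{n-k-1})$. For $0\leq k\leq n/2-1$, $\underline{L}_n^k=K_{k+1}+K_{n-k-1}$. The class $\mathcal{H}_n$ consists of the graphs $G$ of order $n$ with $$K_{\lceil n/2\rceil-1,\lfloor n/2\rfloor+1}\subseteq G\subseteq K_{\lceil n/2\rceil-1}\vee(\lfloor n/2\rfloor+1)K_1,$$ where $\subseteq$ denotes the (spanning) subgraph relation and $K_{a,b}$ is the complete bipartite graph with parts of sizes $a,b$ ($K_{0,b}$ being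 edgeless on $b$ vertices). *)

(* Defs.v *)
From mathcomp Require Import all_boot all_order all_algebra.
From mathcomp Require Import classical_sets reals.

Set Implicit Arguments.
Unset Strict Implicit.
Unset Printing Implicit Defensive.

Import Order.TTheory GRing.Theory Num.Theory.

Record sgraph := SGraph {
  vertex :> finType;
  adj : rel vertex;
  adj_sym : symmetric adj;
  adj_irrefl : irreflexive adj
}.

Definition iso (G H : sgraph) : Prop :=
  exists2 f : G -> H, bijective f & forall x y, adj (f x) (f y) = adj x y.

(* [G] is, up to isomorphism, a subgraph of [H] with the same vertex set. *)
Definition spanning_subgraph (G H : sgraph) : Prop :=
  exists2 f : G -> H, bijective f & forall x y, adj x y -> adj (f x) (f y).

Section Complement.
Variable G : sgraph.
Definition compl_adj : rel G := fun x y => (x != y) && ~~ adj x y.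
Lemma compl_adj_sym : symmetric compl_adj.
Proof. by move=> x y; rewrite /compl_adj eq_sym adj_sym. Qed.
Lemma compl_adj_irrefl : irreflexive compl_adj.
Proof. by move=> x; rewrite /compl_adj eqxx. Qed.
Definition gcompl := SGraph compl_adj_sym compl_adj_irrefl.
End Complement.

Section Complete.
Variable n : nat.
Definition complete_adj : rel 'I_n := fun x y => x != y.
Lemma complete_adj_sym : symmetric complete_adj.
Proof. by move=> x y; rewrite /complete_adj eq_sym. Qed.
Lemma complete_adj_irrefl : irreflexive complete_adj.
Proof. by move=> x; rewrite /complete_adj eqxx. Qed.
Definition complete := SGraph complete_adj_sym complete_adj_irrefl.
End Complete.

Section CompleteBipartite.
Variables a b : nat.
Definition bipartite_adj : rel ('I_a + 'I_b)%type := fun x y =>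
  match x, y with
  | inl _, inr _ | inr _, inl _ => true
  | _, _ => false
  end.
Lemma bipartite_adj_sym : symmetric bipartite_adj.
Proof. by case=> x [] y. Qed.
Lemma bipartite_adj_irrefl : irreflexive bipartite_adj.
Proof. by case. Qed.
Definition complete_bipartite := SGraph bipartite_adj_sym bipartite_adj_irrefl.
End CompleteBipartite.

Section UnionJoin.
Variables G H : sgraph.

Definition union_adj : rel (G + H)%type := fun x y =>
  match x, y with
  | inl u, inl v => adj u v
  | inr u, inr v => adj u v
  | _, _ => false
  end.
Lemma union_adj_sym : symmetric union_adj.
Proof. by case=> x [] y //=; exact: adj_sym. Qed.
Lemma union_adj_irrefl : irreflexive union_adj.
Proof. by case=> x /=; exact: adj_irrefl. Qed.
Definition gunion := SGraph union_adj_sym union_adj_irrefl.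

Definition join_adj : rel (G + H)%type := fun x y =>
  match x, y with
  | inl u, inl v => adj u v
  | inr u, inr v => adj u v
  | _, _ => true
  end.
Lemma join_adj_sym : symmetric join_adj.
Proof. by case=> x [] y //=; exact: adj_sym. Qed.
Lemma join_adj_irrefl : irreflexive join_adj.
Proof. by case=> x /=; exact: adj_irrefl. Qed.
Definition gjoin := SGraph join_adj_sym join_adj_irrefl.
End UnionJoin.

Section Copies.
Variables (k : nat) (G : sgraph).
Definition copies_adj : rel ('I_k * G)%type := fun x y =>
  (x.1 == y.1) && adj x.2 y.2.
Lemma copies_adj_sym : symmetric copies_adj.
Proof. by move=> x y; rewrite /copies_adj eq_sym adj_sym. Qed.
Lemma copies_adj_irrefl : irreflexive copies_adj.
Proof. by move=> x; rewrite /copies_adj adj_irrefl andbF. Qed.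
Definition copies := SGraph copies_adj_sym copies_adj_irrefl.
End Copies.

Definition degree (G : sgraph) (x : G) : nat := #|[pred y | adj x y]|.

(* The default value #|G| exceeds every degree, so it only matters when G has
   no vertex. *)
Definition min_degree (G : sgraph) : nat :=
  \big[minn/#|G|]_(x : G) degree x.

Definition traceable (G : sgraph) : Prop :=
  exists (x : G) (p : seq G),
    [/\ path (@adj G) x p, uniq (x :: p) & forall y, y \in x :: p].

(* A cycle has at least 3 vertices; without this bound, [ucycle] would accept
   an edge as a closed walk of length 2. *)
Definition hamiltonian (G : sgraph) : Prop :=
  exists c : seq G,
    [/\ ucycle (@adj G) c, (2 < size c)%N & forall y, y \in c].

Definition adjacency (R : realType) (G : sgraph) : 'M[R]_#|G| :=
  \matrix_(i, j) (adj (enum_val i) (enum_val j))%:R%R.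

(* The set of eigenvalues is finite, and nonempty when G has a vertex since
   the matrix is real symmetric, so this supremum is the largest eigenvalue. *)
Definition spectral_radius (R : realType) (G : sgraph) : R :=
  sup [set a : R | eigenvalue (adjacency R G) a]%classic.

(* K_1 \/ (K_k + K_{n-k-1}); used only for 1 <= k <= (n-1)/2. *)
Definition L (n k : nat) : sgraph :=
  gjoin (complete 1) (gunion (complete k) (complete (n - k - 1))).

(* K_{k+1} + K_{n-k-1}; used only for 0 <= k <= n/2 - 1. *)
Definition L_under (n k : nat) : sgraph :=
  gunion (complete k.+1) (complete (n - k - 1)).

(* [uphalf n] is the ceiling and [n./2] the floor of n/2. *)
Definition class_H (n : nat) (G : sgraph) : Prop :=
  [/\ #|G| = n,
      spanning_subgraph (complete_bipartite (uphalf n).-1 n./2.+1) G &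
      spanning_subgraph G
        (gjoin (complete (uphalf n).-1) (copies n./2.+1 (complete 1)))].

(* Main.v *)
Require Import Defs.
From mathcomp Require Import all_boot all_order all_algebra.
From mathcomp Require Import complex polyrcf zify ring.
From mathcomp Require Import boolp classical_sets reals.

(* Part (2). If G is not Hamiltonian, enlarge it to a maximal non-Hamiltonian
   graph e on the same vertices: non-adjacent vertices of e are then the ends of
   a Hamiltonian path of e, and by Ore's argument their degrees sum to at most
   n - 1.

   For n = 2k + 1 the minimum degree alone decides, and no spectrum is needed.
   Along a Hamiltonian path v_0 .. v_2k of e, exactly one of v_0 ~ v_(i+1) and
   v_i ~ v_2k holds for each i.  Either some i has v_0 ~ v_(i+1) and
   v_(i-1) ~ v_2k, and then a cycle misses only v_i, whose neighbours' successors
   on the cycle form with v_i an independent set of size k + 1 (class H_n); or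
   the neighbours of v_0 are v_1 .. v_k and those of v_2k are v_k .. v_(2k-1),
   and then the first k vertices are not adjacent to the last k (L_n^k).

   For n > 2k + 1, let h be the complement of e; its degrees d are at most
   m = n - k - 1 and sum to at least k + m along an edge, so d(u) d(v) >= k m
   along an edge.  The test vector sqrt(d) has Rayleigh quotient at least
   sqrt(k m) for the complement of G, which is the largest value allowed.
   Equality forces d(u) d(v) = k m along the edges of h, makes the complement of
   G agree with h off the isolated vertices of h, and h is K_{k,m} with one
   isolated vertex.

   Part (1) is part (2) applied to K_1 \/ G, with k + 1 for k. *)

Set Implicit Arguments.
Unset Strict Implicit.
Unset Printing Implicit Defensive.

Import Order.TTheory GRing.Theory Num.Theory.

(** * Rayleigh quotients and eigenvalues of graphs *)

Section Spectral.
Local Open Scope ring_scope.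
Local Open Scope complex_scope.
Local Open Scope sesquilinear_scope.

(** The spectral theorem is applied over [R[i]], where the symmetric A becomes Hermitian. In an
    orthonormal eigenbasis the two sides are sums of the same squared moduli, weighted by the
    eigenvalues and by r. *)
Lemma rayleigh (R : rcfType) n (A : 'M[R]_n) (r : R) (v : 'rV_n) :
  A^T = A -> (forall a, eigenvalue A a -> a <= r) ->
  (v *m A *m v^T) 0 0 <= r * (v *m v^T) 0 0.
Proof.
move=> Asym le_r.
pose f := real_complex R; pose AC := map_mx f A; pose vC := map_mx f v.
have ACherm : AC \is hermsymmx.
  apply: realsym_hermsym.
    apply/is_hermitianmxP; rewrite expr0 scale1r.
    by apply/matrixP => i j; rewrite !mxE /= -[in LHS]Asym mxE.
  by apply/mxOverP => i j; rewrite mxE; apply/complex_realP; exists (A i j).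
set P := spectralmx AC; set d := spectral_diag AC.
have Punit : P \is unitarymx by exact: spectral_unitarymx.
have ACE : AC = P^t* *m diag_mx d *m P.
  by rewrite -invmx_unitary //; apply/orthomx_spectralP/hermitian_normalmx.
have PtP : P^t* *m P = 1%:M by rewrite -invmx_unitary // mulVmx ?spectral_unit.
have d_le i : d 0 i <= f r.
  have /mxOverP /(_ 0 i) /complex_realP [a da] :=
    hermitian_spectral_diag_real ACherm.
  (* A real eigenvalue of the complexified matrix is an eigenvalue of A, because the characteristic
     polynomial is the same. *)
  rewrite /d da lecR; apply: le_r; rewrite eigenvalue_root_char.
  rewrite -(fmorph_root f) map_char_poly -eigenvalue_root_char.
  apply/eigenvalueP; exists (row i P); last first.
    apply/eqP => Pi0; have : row i (1%:M : 'M[R[i]]_n) = 0.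
      by rewrite -(unitarymxP Punit) row_mul Pi0 mul0mx.
    move/rowP/(_ i); rewrite !mxE eqxx; move/eqP.
    by rewrite oner_eq0.
  rewrite -/AC -row_mul ACE !mulmxA (unitarymxP Punit) mul1mx.
  by rewrite row_mul row_diag_mx -scalemxAl -rowE da.
have vCt : vC^T = vC^t*.
  apply/matrixP => i j; rewrite !mxE conj_Creal //.
  by apply/complex_realP; exists (v j i).
pose w := vC *m P^t*.
have wt : w^t* = P *m vC^T by rewrite trmx_mul map_mxM trmxCK -vCt.
have q1 : f ((v *m A *m v^T) 0 0) = \sum_i d 0 i * `|w 0 i| ^+ 2.
  transitivity ((vC *m AC *m vC^T) 0 0).
    by rewrite map_trmx -!map_mxM [RHS]mxE.
  rewrite ACE; transitivity ((w *m diag_mx d *m w^t*) 0 0).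
    by rewrite wt /w !mulmxA.
  rewrite mul_mx_diag mxE; apply: eq_bigr => i _.
  by rewrite !mxE normCK mulrA (mulrC (d 0 i)).
have q2 : f ((v *m v^T) 0 0) = \sum_i `|w 0 i| ^+ 2.
  transitivity ((vC *m vC^T) 0 0).
    by rewrite map_trmx -!map_mxM [RHS]mxE.
  transitivity ((w *m w^t*) 0 0).
    by rewrite wt /w -mulmxA (mulmxA _ P) PtP mul1mx.
  by rewrite mxE; apply: eq_bigr => i _; rewrite !mxE normCK.
rewrite -lecR rmorphM -!/(f _) q1 [X in _ * X]q2 mulr_sumr ler_sum // => i _.
by rewrite ler_wpM2r ?exprn_ge0.
Qed.

End Spectral.

Section GraphSpectrum.
Local Open Scope ring_scope.
Variable R : realType.

Lemma adjacency_sym (G : sgraph) : (adjacency R G)^T = adjacency R G.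
Proof. by apply/matrixP => i j; rewrite !mxE adj_sym. Qed.

Lemma sum_enum_val (G : sgraph) (F : G -> R) :
  \sum_(i < #|G|) F (enum_val i) = \sum_x F x.
Proof. by rewrite (reindex _ (onW_bij _ (enum_val_bij G))). Qed.

Lemma eigenvalue_adjacencyP (G : sgraph) (a : R) :
  reflect (exists2 f : G -> R,
             forall y, \sum_(x | adj x y) f x = a * f y & exists x, f x != 0)
          (eigenvalue (adjacency R G) a).
Proof.
apply: (iffP eigenvalueP) => [[v vA v0] | [f fA [x fx0]]].
  exists (fun x => v 0 (enum_rank x)) => [y|].
    have /rowP /(_ (enum_rank y)) := vA; rewrite !mxE => <-.
    rewrite big_mkcond -sum_enum_val; apply: eq_bigr => i _.
    rewrite !mxE enum_valK enum_rankK.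
    by case: adj; rewrite ?mulr1 ?mulr0.
  have [i vi0] : exists i, v 0 i != 0.
    apply/existsP; rewrite -[X in is_true X]negbK negb_exists.
    apply: contra v0 => /forallP v0; apply/eqP/rowP => i; rewrite mxE.
    by apply/eqP; rewrite -[X in is_true X]negbK.
  by exists (enum_val i); rewrite enum_valK.
exists (\row_i f (enum_val i)); last first.
  apply: contraNneq fx0 => /rowP /(_ (enum_rank x)).
  by rewrite !mxE enum_rankK => ->.
apply/rowP => j; rewrite !mxE -fA [RHS]big_mkcond -sum_enum_val.
by apply: eq_bigr => i _; rewrite !mxE; case: adj; rewrite ?mulr1 ?mulr0.
Qed.

Lemma eigenvalue_le_spectral_radius (G : sgraph) (a : R) :
  eigenvalue (adjacency R G) a -> a <= spectral_radius R G.
Proof.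
move=> aG; apply: ub_le_sup => //.
(* [sup] is an upper bound only of a bounded set; eigenvalues are roots of the characteristic
   polynomial, hence at most its Cauchy bound. *)
exists (cauchy_bound (char_poly (adjacency R G))) => b /=.
rewrite eigenvalue_root_char => /eqP b0.
apply: (le_trans (ler_norm b)); apply/ltW/cauchy_boundP => //.
exact: monic_neq0 (char_poly_monic _).
Qed.

Lemma spectral_radius_le (G : sgraph) (r : R) : 0 <= r ->
  (forall a, eigenvalue (adjacency R G) a -> a <= r) ->
  spectral_radius R G <= r.
Proof.
move=> r0 le_r; rewrite /spectral_radius.
have [[a aG]|S0] := pselect (exists a, eigenvalue (adjacency R G) a).
  by apply: ge_sup; [exists a | move=> b; exact: le_r].
(* Without eigenvalues the supremum takes its default value 0; this is where 0 <= r enters. *)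
rewrite (_ : [set a | _]%classic = set0) ?sup0 //.
by apply/seteqP; split=> // b /= bG; case: S0; exists b.
Qed.

Lemma rayleigh_adjacency (G : sgraph) (r : R) (x : G -> R) :
  (forall a, eigenvalue (adjacency R G) a -> a <= r) ->
  \sum_u \sum_v (adj u v)%:R * (x u * x v) <= r * \sum_u x u ^+ 2.
Proof.
move=> le_r.
pose v : 'rV[R]_#|G| := \row_i x (enum_val i).
have -> : \sum_u \sum_v (adj u v)%:R * (x u * x v) =
    (v *m adjacency R G *m v^T) 0 0.
  rewrite mxE exchange_big -sum_enum_val; apply: eq_bigr => i _.
  rewrite !mxE mulr_suml -sum_enum_val; apply: eq_bigr => j _.
  by rewrite !mxE mulrAC mulrC.
have -> : \sum_u x u ^+ 2 = (v *m v^T) 0 0.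
  by rewrite mxE -sum_enum_val; apply: eq_bigr => i _; rewrite !mxE expr2.
exact: rayleigh (adjacency_sym G) le_r.
Qed.

(** The complement is K_{p,q}. On each side a f is constant, equal to the sum of f over the other
    side. Hence a S = p T and a T = q S, so either a^2 = p q, or S = T = 0 and then a f = 0. *)
Lemma eigenvalue_compl_union_complete (p q : nat) (a : R) :
  eigenvalue (adjacency R (gcompl (gunion (complete p) (complete q)))) a ->
  a <= Num.sqrt (p * q)%:R.
Proof.
case/eigenvalue_adjacencyP => f fA [x fx0].
pose S := \sum_i f (inl i); pose T := \sum_j f (inr j).
have fl i : a * f (inl i) = T.
  rewrite -fA big_sumType /= big_pred0 ?add0r => [|j].
    by apply: eq_bigl => j; rewrite /compl_adj.
  by rewrite /compl_adj /= negbK; exact: andNb.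
have fr j : a * f (inr j) = S.
  rewrite -fA big_sumType /= [X in _ + X]big_pred0 ?addr0 => [|i].
    by apply: eq_bigl => i; rewrite /compl_adj.
  by rewrite /compl_adj /= negbK; exact: andNb.
have aS : a * S = p%:R * T.
  by rewrite mulr_sumr (eq_bigr _ (fun i _ => fl i)) sumr_const card_ord mulr_natl.
have aT : a * T = q%:R * S.
  by rewrite mulr_sumr (eq_bigr _ (fun i _ => fr i)) sumr_const card_ord mulr_natl.
have zS : (a ^+ 2 - (p * q)%:R) * S = 0.
  have -> : (a ^+ 2 - (p * q)%:R) * S = a * (a * S) - p%:R * (q%:R * S) by ring.
  by rewrite aS -aT; ring.
have zT : (a ^+ 2 - (p * q)%:R) * T = 0.
  have -> : (a ^+ 2 - (p * q)%:R) * T = a * (a * T) - q%:R * (p%:R * T) by ring.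
  by rewrite aT -aS; ring.
have [/eqP|a2] := eqVneq (a ^+ 2 - (p * q)%:R) 0.
  by rewrite subr_eq0 => /eqP <-; rewrite sqrtr_sqr ler_norm.
suff -> : a = 0 by exact: sqrtr_ge0.
move/eqP: zS; rewrite mulf_eq0 (negPf a2) => /eqP S0.
move/eqP: zT; rewrite mulf_eq0 (negPf a2) => /eqP T0.
apply/eqP; have /eqP : a * f x = 0 by case: (x) => i; rewrite ?fl ?fr.
by rewrite mulf_eq0 (negPf fx0) orbF.
Qed.

(** The added vertex is isolated in the complement: an eigenvector restricts to an eigenvector on G,
    unless it lives on that vertex alone and a = 0. *)
Lemma eigenvalue_compl_join1 (G : sgraph) (a : R) :
  eigenvalue (adjacency R (gcompl (gjoin (complete 1) G))) a ->
  a = 0 \/ eigenvalue (adjacency R (gcompl G)) a.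
Proof.
case/eigenvalue_adjacencyP => f fA [x fx0].
have f0 : a * f (inl ord0) = 0.
  rewrite -fA big_sumType /= !big_pred0 ?addr0 // => i.
  by rewrite /compl_adj /= /complete_adj !ord1.
have fG y : \sum_(u : gcompl G | adj u y) f (inr u) = a * f (inr y).
  rewrite -fA big_sumType /= [X in _ = X + _]big_pred0 ?add0r => [|i].
    by apply: eq_bigl => v; rewrite /compl_adj.
  by rewrite /compl_adj.
have [/existsP [u fu0]|] := boolP [exists u, f (inr u) != 0].
  right; apply/eigenvalue_adjacencyP; exists (fun u => f (inr u)) => //.
  by exists u.
rewrite negb_exists => /forallP fG0; left; case: x fx0 => [i|u fu0].
  by rewrite (ord1 i); move/eqP: f0; rewrite mulf_eq0 => /orP[/eqP //|->].
by have := fG0 u; rewrite fu0.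
Qed.

End GraphSpectrum.

(** * Hamiltonian cycles *)

Section SeqLemmas.
Variables (T : Type) (e : rel T) (d : T).

Lemma sorted_cat_last_head s1 s2 : 0 < size s1 -> 0 < size s2 ->
  sorted e (s1 ++ s2) = [&& sorted e s1, sorted e s2 & e (last d s1) (head d s2)].
Proof.
case: s1 s2 => [|x1 p1] [|x2 p2] //= _ _; rewrite cat_path /=.
by rewrite [X in _ && X]andbC.
Qed.

Lemma last_cat_nonempty s1 s2 :
  0 < size s2 -> last d (s1 ++ s2) = last d s2.
Proof. by case: s2 => //= x p _; rewrite last_cat. Qed.

Lemma head_cat_nonempty s1 s2 :
  0 < size s1 -> head d (s1 ++ s2) = head d s1.
Proof. by case: s1. Qed.

Lemma cycle_cat_sorted s1 s2 : 0 < size s1 -> 0 < size s2 ->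
  cycle e (s1 ++ s2) = [&& sorted e s1, sorted e s2,
    e (last d s1) (head d s2) & e (last d s2) (head d s1)].
Proof.
case: s1 s2 => [|x1 p1] [|x2 p2] //= _ _.
by rewrite rcons_path cat_path last_cat /= -!andbA; congr (_ && _); rewrite andbCA.
Qed.

Lemma head_rev (s : seq T) : head d (rev s) = last d s.
Proof. by case/lastP: s => // s x; rewrite rev_rcons last_rcons. Qed.

Lemma last_rev (s : seq T) : last d (rev s) = head d s.
Proof. by rewrite -head_rev revK. Qed.

Lemma last_take i (s : seq T) : i < size s -> last d (take i.+1 s) = nth d s i.
Proof. by move=> lt_i; rewrite (take_nth d) // last_rcons. Qed.

Lemma head_drop i (s : seq T) : head d (drop i s) = nth d s i.
Proof. by rewrite -nth0 nth_drop addn0. Qed.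

Lemma last_drop i (s : seq T) : i < size s -> last d (drop i s) = last d s.
Proof. by move=> lt_i; rewrite -!nth_last nth_drop size_drop; congr nth; lia. Qed.

Lemma head_take i (s : seq T) : head d (take i.+1 s) = head d s.
Proof. by case: s. Qed.

Lemma take_sorted_rel i s : sorted e s -> sorted e (take i s).
Proof. by rewrite -{1}(cat_take_drop i s) => /cat_sorted2 []. Qed.

Lemma drop_sorted_rel i s : sorted e s -> sorted e (drop i s).
Proof. by rewrite -{1}(cat_take_drop i s) => /cat_sorted2 []. Qed.

Lemma rev_sorted_sym s : symmetric e -> sorted e (rev s) = sorted e s.
Proof. by move=> esym; rewrite rev_sorted; apply: eq_sorted => x y. Qed.

Lemma count_sum_nth (a : pred T) s :
  count a s = \sum_(i < size s) a (nth d s i).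
Proof.
rewrite -sum1_count big_mkcond (big_nth d) big_mkord.
by apply: eq_bigr => i _; case: (a _).
Qed.

End SeqLemmas.

Lemma prev_head (T : eqType) (y : T) p : uniq (y :: p) -> prev (y :: p) y = last y p.
Proof.
by case/andP => yp _; rewrite prev_nth mem_head memNindex // (last_nth y).
Qed.

Section HamiltonPaths.
Variable T : finType.
Implicit Types (e : rel T) (s c : seq T) (u v x y : T).

(** Convertible to [hamiltonian] when e is the adjacency of a graph; a bare relation lets edges be
    added over a fixed vertex type. *)
Definition ham_rel e := exists c : seq T,
  [/\ ucycle e c, 2 < size c & forall y, y \in c].

Definition deg e x := #|[pred y | e x y]|.

Definition ham_path e s := perm_eq s (enum T) /\ sorted e s.

Lemma perm_enum_uniq s : perm_eq s (enum T) -> uniq s.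
Proof. by move/perm_uniq ->; exact: enum_uniq. Qed.

Lemma perm_enum_mem s x : perm_eq s (enum T) -> x \in s.
Proof. by move/perm_mem ->; rewrite mem_enum. Qed.

Lemma perm_enum_size s : perm_eq s (enum T) -> size s = #|T|.
Proof. by move/perm_size ->; rewrite cardE. Qed.

Lemma uniq_perm_enum s : uniq s -> (forall x, x \in s) -> perm_eq s (enum T).
Proof.
by move=> us ms; rewrite uniq_perm ?enum_uniq // => x; rewrite ms mem_enum.
Qed.

Lemma deg_count e x s : perm_eq s (enum T) -> deg e x = count (e x) s.
Proof. by move/permP ->; rewrite /deg cardE enumT size_filter. Qed.

Lemma ham_of_cycle e c : 2 < #|T| -> perm_eq c (enum T) -> cycle e c -> ham_rel e.
Proof.
move=> T2 ec cc; exists c; rewrite (perm_enum_size ec); split=> // [|y].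
  by rewrite /ucycle cc perm_enum_uniq.
exact: perm_enum_mem.
Qed.

(** Ore's exchange: v_0 .. v_i followed by the rest of the path backwards, from the last vertex to
    v_(i+1), closes up through the two given edges. *)
Lemma path_crossing e s d i : symmetric e -> 2 < #|T| -> ham_path e s ->
  i.+1 < size s -> e (head d s) (nth d s i.+1) -> e (nth d s i) (last d s) ->
  ham_rel e.
Proof.
move=> esym T2 [es ss] lt_i e0 e1.
have t0 : 0 < size (take i.+1 s) by rewrite size_takel // ltnW.
have d0 : 0 < size (rev (drop i.+1 s)) by rewrite size_rev size_drop subn_gt0.
apply: (@ham_of_cycle _ (take i.+1 s ++ rev (drop i.+1 s))) => //.
  apply: perm_trans es; rewrite -[X in perm_eq _ X](cat_take_drop i.+1 s).
  by rewrite perm_cat2l perm_rev.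
rewrite (cycle_cat_sorted e d) // take_sorted_rel // rev_sorted_sym //.
rewrite drop_sorted_rel //= head_rev last_drop // last_take ?(ltnW lt_i) //.
by rewrite last_rev head_take head_drop e1 esym.
Qed.

Lemma deg_head e s d : irreflexive e -> perm_eq s (enum T) ->
  deg e (head d s) = \sum_(i < #|T|.-1) e (head d s) (nth d s i.+1).
Proof.
move=> eirr es; rewrite (deg_count e _ es) -(perm_enum_size es).
case: s es => [|x p _] /=; first by rewrite big_ord0.
by rewrite eirr add0n (count_sum_nth d).
Qed.

Lemma deg_last e s d : symmetric e -> irreflexive e -> perm_eq s (enum T) ->
  deg e (last d s) = \sum_(i < #|T|.-1) e (nth d s i) (last d s).
Proof.
move=> esym eirr es; rewrite (deg_count e _ es) -(perm_enum_size es).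
case/lastP: s es => [|q y _] /=; first by rewrite big_ord0.
rewrite last_rcons size_rcons /=.
rewrite -cats1 count_cat /= eirr !addn0 (count_sum_nth d).
by apply: eq_bigr => i _; rewrite nth_cat ltn_ord esym.
Qed.

(** The consequence of edge-maximal non-Hamiltonicity that the proof uses. The default u of [head]
    and [last] is harmless, as s lists all of T and so is nonempty. *)
Definition saturated e := forall u v, u != v -> ~~ e u v ->
  exists s, [/\ ham_path e s, head u s = u & last u s = v].

Definition add_edge e u v : rel T := fun x y =>
  e x y || ((x == u) && (y == v)) || ((x == v) && (y == u)).

Lemma add_edge_sym e u v : symmetric e -> symmetric (add_edge e u v).
Proof.
move=> esym x y; rewrite /add_edge esym -!orbA; congr (_ || _).
by rewrite orbC ![_ && (x == _)]andbC.
Qed.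

Lemma add_edge_irr e u v : irreflexive e -> u != v -> irreflexive (add_edge e u v).
Proof.
move=> eirr uv x; rewrite /add_edge eirr /=.
by case: (eqVneq x u) => [->|] /=; rewrite ?(negPf uv) ?andbF.
Qed.

(** A Hamiltonian cycle of the enlarged relation must use the new edge; cutting the cycle there
    leaves a path of e between u and v. *)
Lemma ham_add_edge e u v : symmetric e -> u != v -> ~ ham_rel e ->
  ham_rel (add_edge e u v) ->
  exists s, [/\ ham_path e s, head u s = u & last u s = v].
Proof.
move=> esym uv nham [c [/andP [cc uc] c2 mc]].
have [x xc nx] : exists2 x, x \in c & ~~ e x (next c x).
  apply/exists_inP; apply: contra_notT nham; rewrite negb_exists_in.
  move/forall_inP => nx; exists c; split=> //; apply/andP; split=> //.
  by apply: cycle_from_next => // x /nx; rewrite negbK.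
have yc : next c x \in c by rewrite mem_next.
set y := next c x in nx yc.
have exy : add_edge e u v x y by exact: next_cycle cc xc.
have [i p cE] := rot_to yc.
have up : uniq (y :: p) by rewrite -cE rot_uniq.
have cp : cycle (add_edge e u v) (y :: p) by rewrite -cE rot_cycle.
have lastp : last y p = x.
  by rewrite -prev_head // -cE prev_rot // /y prev_next.
have p2 : 1 < size p by have := c2; rewrite -(size_rot i) cE.
have es : perm_eq (y :: p) (enum T).
  by apply: uniq_perm_enum => // z; rewrite -cE mem_rot.
have xyE : (x == u) && (y == v) || (x == v) && (y == u).
  by move: exy; rewrite /add_edge (negPf nx).
have ep : path e y p.
  move: cp; rewrite /= rcons_path => /andP [/(pathP y) pp _].
  apply/(pathP y) => i0 lt_i; have := pp i0 lt_i.
  have noty : nth y p i0 <> y.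
    by move=> iy; case/andP: up => /negP []; rewrite -[X in X \in _]iy mem_nth.
  (* The cut edge cannot recur in the other direction: a step from y to x would make p a single
     vertex, while the cycle has at least 3 vertices. *)
  have notyx : nth y (y :: p) i0 = y -> nth y p i0 = x -> False.
    move=> /eqP; rewrite -[X in _ == X]/(nth y (y :: p) 0).
    rewrite nth_uniq // => [/eqP i00|].
      rewrite i00 -lastp -nth_last => /eqP.
      by rewrite nth_uniq //; [lia|lia|lia|case/andP: up].
    by rewrite ltnS ltnW.
  case/orP => [/orP [//|]|] /andP [/eqP aE /eqP bE].
    case/orP: xyE => /andP [/eqP xE /eqP yE]; first by case: noty; rewrite bE yE.
    by case: notyx; rewrite ?aE ?bE.
  case/orP: xyE => /andP [/eqP xE /eqP yE]; last by case: noty; rewrite bE yE.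
  by case: notyx; rewrite ?aE ?bE.
case/orP: xyE => /andP [/eqP xu /eqP yv]; last first.
  exists (y :: p); split=> //=.
  by rewrite -xu -lastp; case: (p) p2.
exists (rev (y :: p)); rewrite head_rev last_rev /=; split=> //.
  by split; [rewrite perm_rev | rewrite rev_sorted_sym].
by rewrite -xu -lastp; case: (p) p2.
Qed.

(** Induction on the number of non-adjacent ordered pairs, which drops with every added edge. Once
    each missing edge would create a Hamiltonian cycle, [ham_add_edge] gives saturation. *)
Lemma ham_saturation e : symmetric e -> irreflexive e -> ~ ham_rel e ->
  exists e', [/\ symmetric e', irreflexive e', subrel e e', ~ ham_rel e' &
    saturated e'].
Proof.
have [n] := ubnP #|[pred uv : T * T | ~~ e uv.1 uv.2]|.
elim: n e => // n IHn e; rewrite ltnS => le_n esym eirr nham.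
have [sat|] := pselect (forall u v, u != v -> ~~ e u v -> ham_rel (add_edge e u v)).
  exists e; split=> // u v uv nuv; apply: ham_add_edge => //; exact: sat.
move=> /existsNP [u /existsNP [v /not_implyP [uv /not_implyP [nuv nham']]]].
have sub : subrel e (add_edge e u v) by move=> x y exy; rewrite /add_edge exy.
have [||||e' [esym' eirr' sub' nham'' sat]] := IHn (add_edge e u v).
- apply: leq_trans le_n; apply: proper_card; apply/properP; split.
    by apply/fintype.subsetP => -[x y]; rewrite !inE /=; apply: contra; exact: sub.
  by exists (u, v); rewrite !inE /add_edge /= ?negbK ?eqxx ?orbT.
- exact: add_edge_sym.
- exact: add_edge_irr.
- exact: nham'.
by exists e'; split=> // x y /sub /sub'.
Qed.

(** Along a Hamiltonian path from u to v, each of the #|T| - 1 positions contributes at most 1 to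
    the two degrees together, by [path_crossing]. *)
Lemma saturated_ore e u v : symmetric e -> irreflexive e -> 2 < #|T| ->
  ~ ham_rel e -> saturated e -> u != v -> ~~ e u v -> deg e u + deg e v < #|T|.
Proof.
move=> esym eirr T2 nham sat uv nuv.
have [s [hs hu hv]] := sat u v uv nuv; have [es _] := hs.
have -> : deg e u = deg e (head u s) by rewrite hu.
have -> : deg e v = deg e (last u s) by rewrite hv.
rewrite deg_head // deg_last // -big_split /=.
apply: (@leq_ltn_trans (\sum_(i < #|T|.-1) 1)); last first.
  by rewrite sum1_card card_ord prednK // ltnW // ltnW.
apply: leq_sum => i _.
have [e1|_] := boolP (e (head u s) (nth u s i.+1)); last by case: (e _ _).
have [e2|_] := boolP (e (nth u s i) (last u s)) => //.
case: nham; apply: path_crossing e1 e2 => //.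
by rewrite (perm_enum_size es) -ltn_predRL ltn_ord.
Qed.

Lemma prev_split (x y : T) p1 p2 : y \notin p1 -> x != y ->
  prev (x :: p1 ++ y :: p2) y = last x p1.
Proof.
move=> yp1 xy; rewrite prev_nth inE mem_cat mem_head !orbT index_cat.
rewrite (negPf yp1) /= eqxx addn0 (last_nth x) -cat_cons nth_cat /=.
by rewrite ltnSn.
Qed.

(** * Cycles through all vertices but one *)

Section CycleMissingOneVertex.
Variables (e : rel T) (z : T) (c : seq T).
Hypotheses (esym : symmetric e) (eirr : irreflexive e) (T2 : 2 < #|T|).
Hypotheses (nham : ~ ham_rel e) (cc : cycle e c).
Hypothesis ezc : perm_eq (z :: c) (enum T).

Let uzc : uniq (z :: c). Proof. exact: perm_enum_uniq ezc. Qed.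

Let mem_c x : x != z -> x \in c.
Proof. by move=> xz; have := perm_enum_mem x ezc; rewrite inE (negPf xz). Qed.

Let nbr_c x : e z x -> x \in c.
Proof. by move=> zs; apply: mem_c; apply: contraTneq zs => ->; rewrite eirr. Qed.

Let rot_next x : x \in c -> exists2 p, perm_eq (z :: next c x :: p) (enum T) &
  [/\ path e (next c x) p, last (next c x) p = x &
      forall y, prev (next c x :: p) y = prev c y].
Proof.
case/andP: (uzc) => zc uc sc.
have yc : next c x \in c by rewrite mem_next.
have [i p cE] := rot_to yc.
exists p.
  by apply: perm_trans ezc; rewrite perm_cons -cE perm_rot.
have pE y : prev (next c x :: p) y = prev c y by rewrite -cE prev_rot.
split=> //.
  by have := cc; rewrite -(rot_cycle i) cE /= rcons_path => /andP [].
by rewrite -prev_head ?pE ?prev_next // -cE rot_uniq.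
Qed.

(** Otherwise z could be inserted between x and its successor. *)
Lemma nbr_next_nonadj x : e z x -> ~~ e z (next c x).
Proof.
move=> zs; apply/negP => zy; case: nham.
have [p ep [pp lp _]] := rot_next (nbr_c zs).
by apply: ham_of_cycle ep _ => //=; rewrite zy rcons_path pp lp esym.
Qed.

(** Write x+ and t+ for the successors. If they were adjacent, one could go from z to x, backwards
    along the cycle to t+, across to x+, forwards to t and back to z. *)
Lemma next_next_nonadj x t : e z x -> e z t -> ~~ e (next c x) (next c t).
Proof.
move=> zs zt; have [<-|st] := eqVneq (next c x) (next c t); first by rewrite eirr.
apply/negP => yy; case: nham.
have [p ep [pp lp pE]] := rot_next (nbr_c zs).
have tp : next c t \in p.
  have := perm_enum_mem (next c t) ep; rewrite !inE (eq_sym _ (next c x)) (negPf st).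
  case/orP => // /eqP tz; case/andP: uzc => /negP []; rewrite -tz.
  by rewrite mem_next nbr_c.
case/splitPr: tp => p1 p2 in ep pp lp pE *.
set y := next c x in st yy ep pp lp pE *; set y' := next c t in st yy ep pp lp pE *.
have lt : last y p1 = t.
  rewrite -(@prev_split _ y' p1 p2) //.
    by rewrite pE /y' prev_next //; case/andP: uzc.
  have /= := perm_enum_uniq ep; rewrite cat_uniq /= negb_or.
  by case/and5P => _ _ _ /andP [].
apply: (@ham_of_cycle _ ((z :: rev (y' :: p2)) ++ (y :: p1))) => //.
  apply: perm_trans ep; rewrite cat_cons perm_cons perm_catC /= perm_cons perm_cat2l.
  by rewrite perm_rev.
have [p1p p2p] : path e y p1 /\ path e y' p2.
  by move: pp; rewrite cat_path /= => /and3P [].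
rewrite (cycle_cat_sorted e z) // -cat1s (sorted_cat_last_head e z) ?size_rev //.
rewrite last_cat_nonempty ?size_rev // last_rev head_rev rev_sorted_sym //=.
rewrite p1p p2p lt (esym t) zt (esym y') yy.
by rewrite -[last y' p2](last_cat y p1 (y' :: p2)) lp zs.
Qed.

(** I consists of z and the successors of its neighbours. The neighbours themselves lie outside I,
    whence the bound on the sum; for #|T| = 2k + 1 and deg z >= k it forces deg z = k. *)
Lemma nbrs_next_independent :
  exists2 I : {set T}, (deg e z).+1 = #|I| /\ deg e z + #|I| <= #|T| &
    {in I &, forall x y, ~~ e x y}.
Proof.
pose S := [set x | e z x]; pose I := z |: (next c @: S).
have zc : z \notin c by case/andP: uzc.
have uc : uniq c by case/andP: uzc.
have degS : deg e z = #|S| by rewrite /deg cardsE.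
have cardI : #|I| = (deg e z).+1.
  rewrite cardsU1 card_imset ?degS; last exact: can_inj (prev_next uc).
  case: imsetP => // -[x]; rewrite inE => zx zE; case/negP: zc.
  by rewrite zE mem_next nbr_c.
exists I; first split=> //.
  rewrite degS -(cardsC I) addnC leq_add2l subset_leq_card //.
  apply/fintype.subsetP => x; rewrite !inE => zx; rewrite negb_or.
  apply/andP; split; first by apply: contraTneq zx => ->; rewrite eirr.
  apply/imsetP => -[t]; rewrite inE => zt xE.
  by have := nbr_next_nonadj zt; rewrite -xE zx.
move=> x y /finset.setU1P [->|/imsetP [x' zx ->]];
  move=> /finset.setU1P [->|/imsetP [y' zy ->]]; rewrite ?eirr //.
- by rewrite inE in zy; exact: nbr_next_nonadj.
- by rewrite inE in zx; rewrite esym; exact: nbr_next_nonadj.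
by rewrite !inE in zx zy; exact: next_next_nonadj.
Qed.

End CycleMissingOneVertex.

(** * Cycles from Hamiltonian paths, and order 2k + 1 *)

Lemma complete_ham_path e : (forall u v, u != v -> e u v) ->
  ham_path e (enum T).
Proof.
move=> econ; split=> //; apply: pairwise_sorted.
apply: (@sub_pairwise _ [rel x y | x != y]) => [x y|]; first exact: econ.
by rewrite -uniq_pairwise enum_uniq.
Qed.

Lemma saturated_ham_path e : saturated e -> exists s, ham_path e s.
Proof.
move=> sat; have [econ|] := pselect (forall u v, u != v -> e u v).
  by exists (enum T); exact: complete_ham_path.
case/existsNP => u /existsNP [v /not_implyP [uv /negP nuv]].
by have [s []] := sat u v uv nuv; exists s.
Qed.

(** The cycle is v_i .. v_0, v_(i+1) .. v_(j-1), then the last vertex back to v_j; the three given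
    edges join the pieces and close it. *)
Lemma reverse_both_ends_cycle e s d i j : symmetric e -> sorted e s ->
  i.+1 < j -> j < size s -> e (nth d s i) (nth d s j) ->
  e (head d s) (nth d s i.+1) -> e (nth d s j.-1) (last d s) ->
  cycle e (rev (take i.+1 s) ++ take (j - i.+1) (drop i.+1 s) ++ rev (drop j s)).
Proof.
move=> esym ss lt_ij lt_js eij e0 e1.
have szm : 0 < size (take (j - i.+1) (drop i.+1 s)).
  by rewrite size_takel ?subn_gt0 // size_drop leq_sub2r // ltnW.
have szl : 0 < size (rev (drop j s)) by rewrite size_rev size_drop subn_gt0.
have lt_is : i.+1 < size s by exact: ltn_trans lt_js.
rewrite (cycle_cat_sorted e d) ?size_rev ?size_takel ?size_cat ?addn_gt0 ?szm //;
  last exact: ltnW.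
rewrite (sorted_cat_last_head e d) // !rev_sorted_sym // !take_sorted_rel //.
rewrite !drop_sorted_rel //= ?take_sorted_rel ?drop_sorted_rel //=.
rewrite head_cat_nonempty // last_cat_nonempty // !last_rev !head_rev.
rewrite last_drop // head_take head_drop last_take 1?ltnW //.
  have -> : j - i.+1 = (j.-1 - i.+1).+1 by lia.
  rewrite last_take; last by rewrite size_drop; lia.
  rewrite nth_drop head_take head_drop subnKC; last by lia.
  by rewrite e1 e0 esym.
by rewrite drop_sorted_rel.
Qed.

Lemma ham_of_reverse_both_ends e s d i j : symmetric e -> 2 < #|T| ->
  ham_path e s -> i.+1 < j -> j < size s -> e (nth d s i) (nth d s j) ->
  e (head d s) (nth d s i.+1) -> e (nth d s j.-1) (last d s) -> ham_rel e.
Proof.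
move=> esym T2 [es ss] lt_ij lt_js eij e0 e1.
apply: (ham_of_cycle T2 _ (reverse_both_ends_cycle esym ss lt_ij lt_js eij e0 e1)).
apply: perm_trans es; rewrite -[X in perm_eq _ X](cat_take_drop i.+1 s).
rewrite perm_cat ?perm_rev //.
rewrite -[X in perm_eq _ X](cat_take_drop (j - i.+1) (drop i.+1 s)).
by rewrite perm_cat2l perm_rev drop_drop subnK // ltnW.
Qed.

(** The cycle runs from v_(i+1) to the last vertex, jumps to v_(i-1), returns to v_0 and closes at
    v_(i+1); it misses only v_i. *)
Lemma skip_cycle e s d i : symmetric e -> ham_path e s ->
  0 < i -> i.+1 < size s -> e (head d s) (nth d s i.+1) ->
  e (nth d s i.-1) (last d s) ->
  cycle e (drop i.+1 s ++ rev (take i s)).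
Proof.
case: i => // i esym [es ss] _ lt_is e0 e1.
have szl : 0 < size (rev (take i.+1 s)).
  by rewrite size_rev size_takel // ltnW // ltnW.
rewrite (cycle_cat_sorted e d) ?size_drop ?subn_gt0 //.
rewrite rev_sorted_sym // take_sorted_rel // drop_sorted_rel //=.
rewrite head_rev last_rev last_drop // head_drop head_take.
by rewrite last_take 1?ltnW 1?ltnW // esym e1.
Qed.

Lemma perm_skip s d i : i < size s ->
  perm_eq (nth d s i :: drop i.+1 s ++ rev (take i s)) s.
Proof.
move=> lt_is; rewrite -[X in perm_eq _ X](cat_take_drop i s).
by rewrite (drop_nth d lt_is) -cat_cons perm_catC perm_cat2r perm_rev.
Qed.

(** A down-closed predicate holds on an initial segment, whose length is its count. *)
Lemma down_closed_sum (m k : nat) (a : nat -> bool) :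
  (forall i, i.+1 < m -> a i.+1 -> a i) -> \sum_(i < m) a i = k ->
  forall i, i < m -> a i = (i < k).
Proof.
move=> adown; elim: m k adown => [|m IHm] k adown; first by [].
rewrite big_ord_recr /= => sumE i; rewrite ltnS => le_im.
have adown' j : j.+1 < m -> a j.+1 -> a j by move=> /ltnW /adown.
have [am|nam] := boolP (a m); last first.
  rewrite (negPf nam) addn0 in sumE.
  have le_km : k <= m.
    by rewrite -sumE -[leqRHS]card_ord -sum1_card leq_sum // => j _; case: (a j).
  move: le_im; rewrite leq_eqVlt => /orP [/eqP ->|/(IHm k adown' sumE) //].
  by rewrite (negPf nam) ltnNge le_km.
have aT j : j <= m -> a j.
  elim: (m - j) {-2}j (erefl (m - j)) => [|l IHl] {}j jE le_jm.
    by have -> : j = m by lia.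
  by apply: adown; [lia|apply: IHl; lia].
rewrite aT // -sumE am addn1 ltnS.
rewrite (eq_bigr (fun=> 1)) => [|j _]; last by rewrite aT // ltnW.
by rewrite sum1_card card_ord.
Qed.

Lemma half_degree_ham_path e s k : symmetric e -> irreflexive e ->
  0 < k -> #|T| = 2 * k + 1 -> (forall x, k <= deg e x) -> ~ ham_rel e ->
  ham_path e s ->
  (exists2 I : {set T}, #|I| = k.+1 & {in I &, forall x y, ~~ e x y}) \/
  (exists A B : {set T}, [/\ #|A| = k, #|B| = k, [disjoint A & B] &
    forall x y, x \in A -> y \in B -> ~~ e x y]).
Proof.
move=> esym eirr k0 Tk degk nham hs; have [es ss] := hs.
have T2 : 2 < #|T| by lia.
have szs : size s = 2 * k + 1 by rewrite (perm_enum_size es).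
have [d _] : exists d : T, true.
  by case: (s) szs => [|d _ _]; [rewrite addn1|exists d].
pose a i : bool := e (head d s) (nth d s i.+1).
pose b i : bool := e (nth d s i) (last d s).
have ab i : i < 2 * k -> ~~ (a i && b i).
  move=> lt_i; apply/negP => /andP [ai bi]; case: nham.
  by apply: path_crossing ai bi => //; rewrite szs addn1.
have Tk1 : #|T|.-1 = 2 * k by rewrite Tk addn1.
have suma : k <= \sum_(i < 2 * k) a i.
  by have := degk (head d s); rewrite (deg_head d) // Tk1.
have sumb : k <= \sum_(i < 2 * k) b i.
  by have := degk (last d s); rewrite deg_last // Tk1.
(* No position satisfies both a and b, so the three counts add up to 2k; the first two are at least
   k each, so both equal k and the third vanishes. *)
have sumE : \sum_(i < 2 * k) a i + \sum_(i < 2 * k) b i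
            + \sum_(i < 2 * k) ~~ (a i || b i) = 2 * k.
  rewrite -!big_split /= -[RHS]card_ord -sum1_card; apply: eq_bigr => i _.
  by have := ab i (ltn_ord i); case: (a i); case: (b i).
have sumc : \sum_(i < 2 * k) ~~ (a i || b i) = 0 by lia.
have sumak : \sum_(i < 2 * k) a i = k by lia.
have bE i : i < 2 * k -> b i = ~~ a i.
  move=> lt_i; have := ab i lt_i.
  have /eqP := sumc; rewrite sum_nat_eq0 => /forallP /(_ (Ordinal lt_i)) /=.
  by case: (a i); case: (b i).
have [/existsP [i /and3P [i0 ai nai]]|] :=
  boolP [exists i : 'I_(2 * k), [&& 0 < i, a i & ~~ a i.-1]].
  left; rewrite -bE in nai; last by have := ltn_ord i; lia.
  have lt_i : i.+1 < size s by rewrite szs addn1 ltnS ltn_ord.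
  have [|I [cI le_I] indI] := nbrs_next_independent esym eirr T2 nham
    (skip_cycle esym hs i0 lt_i ai nai) (z := nth d s i).
    by apply: perm_trans es; apply: perm_skip; exact: ltnW.
  exists I => //; rewrite -cI; congr S; have := degk (nth d s i); lia.
rewrite negb_exists => /forallP adown; right.
have aE : forall i, i < 2 * k -> a i = (i < k).
  apply: down_closed_sum sumak => i lt_i ai.
  by have := adown (Ordinal lt_i); rewrite /= ai /= negbK.
have us : uniq s by exact: perm_enum_uniq.
have usk : uniq (take k s ++ drop k s) by rewrite cat_take_drop.
(* The sets are v_0 .. v_(k-1) and v_(k+1) .. v_(2k); the middle vertex v_k is left out. An edge
   between them would allow reversing both ends of the path. *)
exists [set x in take k s], [set x in drop k.+1 s]; split.
- by rewrite cardsE (card_uniqP (take_uniq _ us)) size_takel // szs; lia.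
- by rewrite cardsE (card_uniqP (drop_uniq _ us)) size_drop szs; lia.
- rewrite disjoint_subset; apply/fintype.subsetP => x; rewrite !inE => xt.
  apply/negP => xd; move: usk; rewrite cat_uniq => /and3P [_ /hasP nh _].
  case: nh; exists x => //.
  by move: xd; rewrite -addn1 addnC -drop_drop => /mem_drop.
move=> x y; rewrite !inE => /(nthP d) [] i.
rewrite size_takel; last by rewrite szs; lia.
move=> lt_ik <- /(nthP d) [] j; rewrite size_drop nth_drop nth_take // szs => lt_j <-.
apply/negP => eij; case: nham.
apply: (ham_of_reverse_both_ends esym T2 hs _ _ eij); rewrite -/(a _) -/(b _).
- by lia.
- by rewrite szs; lia.
- by rewrite aE //; lia.
- by rewrite bE ?aE; lia.
Qed.

End HamiltonPaths.

(** * Equality in the Rayleigh bound *)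

Section RayleighEquality.
Local Open Scope ring_scope.
Variables (R : realType) (G : sgraph) (r : R).
Hypothesis r_gt0 : 0 < r.
Hypothesis le_r : forall a, eigenvalue (adjacency R G) a -> a <= r.

Lemma sum_indicator (F : G -> R) u : \sum_w (w == u)%:R * F w = F u.
Proof.
rewrite (bigD1 u) //= eqxx mul1r big1 ?addr0 // => w /negPf ->.
by rewrite mul0r.
Qed.

Lemma rayleigh_eq_nbr0 (x : G -> R) u v :
  (forall w, 0 <= x w) ->
  \sum_a \sum_b (adj a b)%:R * (x a * x b) = r * \sum_w x w ^+ 2 ->
  adj u v -> x u = 0 -> x v = 0.
Proof.
move=> x0 Qx uv xu0; pose S := \sum_b (adj u b)%:R * x b.
(* Moving the maximizer x by t at u adds 2tS to the left and only r t^2 to the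
   right; with t = S / r this contradicts maximality unless S = 0. *)
pose t := S / r; pose y w := x w + t * (w == u)%:R.
have Qy : \sum_a \sum_b (adj a b)%:R * (y a * y b) =
    \sum_a \sum_b (adj a b)%:R * (x a * x b) + 2 * t * S.
  transitivity (\sum_a (\sum_b (adj a b)%:R * (x a * x b) +
    (t * ((a == u)%:R * \sum_b (adj a b)%:R * x b) +
    (t * (x a * \sum_b (b == u)%:R * (adj a b)%:R) +
     t ^+ 2 * ((a == u)%:R * \sum_b (b == u)%:R * (adj a b)%:R))))).
    apply: eq_bigr => a _; rewrite !mulr_sumr -!big_split /=.
    by apply: eq_bigr => b _; rewrite /y; ring.
  rewrite !big_split /= -!mulr_sumr; congr (_ + _).
  under [X in _ + (_ * X + _)]eq_bigr do rewrite sum_indicator.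
  under [X in _ + (_ + _ * X)]eq_bigr do rewrite sum_indicator.
  rewrite !sum_indicator adj_irrefl -/S.
  have -> : \sum_i x i * (adj i u)%:R = S.
    by apply: eq_bigr => i _; rewrite adj_sym mulrC.
  by rewrite mulr0 addr0; ring.
have y2 : \sum_w y w ^+ 2 = \sum_w x w ^+ 2 + t ^+ 2.
  transitivity (\sum_w (x w ^+ 2 + (w == u)%:R * (2 * t * x w + t ^+ 2))).
    apply: eq_bigr => w _; rewrite /y.
    by case: eqP => _ /=; ring.
  by rewrite big_split /= sum_indicator xu0 mulr0 add0r.
have := rayleigh_adjacency y le_r; rewrite Qy y2 Qx mulrDr lerD2l.
have -> : r * t ^+ 2 = t * S by rewrite /t; field; rewrite gt_eqF.
rewrite -mulrA -subr_le0 => le0.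
have S0 : 0 <= S by apply: sumr_ge0 => b _; rewrite mulr_ge0.
have SS : S * S <= 0.
  have -> : S * S = r * (2 * (t * S) - t * S).
    by rewrite /t; field; rewrite gt_eqF.
  by rewrite pmulr_rle0.
have /eqP S_0 : S == 0.
  by rewrite -sqrf_eq0 expr2 eq_le SS mulr_ge0.
have /(_ v isT) := psumr_eq0P (fun b _ => mulr_ge0 (ler0n _ _) (x0 b)) S_0.
by rewrite uv mul1r.
Qed.

End RayleighEquality.

Section SpanningSubgraphEquality.
Local Open Scope ring_scope.
Variables (R : realType) (G : sgraph) (h : rel G) (N : nat).
Hypotheses (N_gt0 : (0 < N)%N) (hadj : subrel h (@adj G)).
Hypothesis le_r :
  forall a, eigenvalue (adjacency R G) a -> a <= Num.sqrt N%:R.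
Hypothesis degN : forall u v, h u v -> (N <= deg h u * deg h v)%N.

Let r : R := Num.sqrt N%:R.
Let x u : R := Num.sqrt (deg h u)%:R.

Lemma deg_natr_sum u : (deg h u)%:R = \sum_v (h u v)%:R :> R.
Proof.
rewrite /deg -sum1_card natr_sum big_mkcond.
by apply: eq_bigr => v _; rewrite inE; case: (h u v).
Qed.

(** The difference F of the two sides is nonnegative, on edges of h by [degN]. As x_u^2 = deg h u,
    summing F over all pairs gives the Rayleigh form of x minus r times its squared norm, which is
    at most 0; so every F vanishes. *)
Lemma degree_vector_equality u v :
  (adj u v)%:R * (x u * x v) = (h u v)%:R * r.
Proof.
pose F u v := (adj u v)%:R * (x u * x v) - (h u v)%:R * r.
have F0 a b : 0 <= F a b.
  rewrite /F; case hab : (h a b).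
    rewrite (hadj hab) !mul1r subr_ge0 /r /x -sqrtrM ?ler0n // -natrM.
    by rewrite ler_wsqrtr // ler_nat degN.
  by rewrite mul0r subr0 !mulr_ge0 ?sqrtr_ge0.
have sumF : \sum_a \sum_b F a b =
    \sum_a \sum_b (adj a b)%:R * (x a * x b) - r * \sum_a x a ^+ 2.
  rewrite mulr_sumr -sumrB; apply: eq_bigr => a _.
  by rewrite sumrB -mulr_suml -deg_natr_sum sqr_sqrtr // mulrC.
have sumF0 : \sum_a \sum_b F a b = 0.
  apply/eqP; rewrite eq_le sumr_ge0 ?andbT => [|a _]; last exact: sumr_ge0.
  by rewrite sumF subr_le0 rayleigh_adjacency.
have := psumr_eq0P (fun a _ => sumr_ge0 _ (fun b _ => F0 a b)) sumF0.
move=> /(_ u isT) sumFu.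
have := psumr_eq0P (fun b _ => F0 u b) sumFu; move=> /(_ v isT) /eqP.
by rewrite subr_eq0 => /eqP.
Qed.

Lemma subgraph_degree_product u v : h u v -> (deg h u * deg h v)%N = N.
Proof.
move=> huv; have := degree_vector_equality u v.
rewrite (hadj huv) huv !mul1r /x /r -sqrtrM // -natrM => /eqP.
by rewrite eqr_sqrt // eqr_nat => /eqP.
Qed.

(** On such an edge x_u x_v = 0, so x vanishes at one end. Since x attains the Rayleigh bound,
    [rayleigh_eq_nbr0] carries the zero to the other end. *)
Lemma non_subgraph_edge_isolated u v : adj u v -> ~~ h u v ->
  (deg h u = 0 /\ deg h v = 0)%N.
Proof.
have x0 w : (x w == 0) = (deg h w == 0)%N.
  by rewrite sqrtr_eq0 lern0.
have r0 : 0 < r by rewrite sqrtr_gt0 ltr0n.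
have Qx : \sum_a \sum_b (adj a b)%:R * (x a * x b) = r * \sum_w x w ^+ 2.
  rewrite mulr_sumr; apply: eq_bigr => a _.
  rewrite (eq_bigr _ (fun b _ => degree_vector_equality a b)).
  by rewrite -mulr_suml -deg_natr_sum sqr_sqrtr // mulrC.
have nbr a b : adj a b -> x a = 0 -> x b = 0.
  by apply: rayleigh_eq_nbr0 Qx => // w; exact: sqrtr_ge0.
move=> uv nuv; have := degree_vector_equality u v.
rewrite uv (negPf nuv) mul1r mul0r => /eqP; rewrite mulf_eq0.
case/orP => /eqP z0; have z1 := nbr _ _ _ z0.
  by split; apply/eqP; rewrite -x0 ?z0 ?z1.
by split; apply/eqP; rewrite -x0 ?z0 ?z1 // adj_sym.
Qed.

End SpanningSubgraphEquality.

(** * Extremal configurations *)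

(** The sum condition gives a b >= k m + (a - k)(m - a), so a cannot lie strictly between k and
    m. *)
Lemma degrees_at_extremes k m a b : a <= m -> b <= m -> k + m <= a + b ->
  a * b = k * m -> (a = k /\ b = m) \/ (a = m /\ b = k).
Proof.
move=> am bm ab abE.
have [a_eq_m|a_neq_m] := eqVneq a m.
  right; split=> //; apply/eqP; have [m0|m_gt0] := posnP m; first by lia.
  by rewrite -(eqn_pmul2l m_gt0) -{1}a_eq_m abE mulnC.
have [a_eq_k|a_neq_k] := eqVneq a k; first by left; split=> //; lia.
have [i iE] : exists i, a = k + i.+1 by exists (a - k).-1; lia.
have [j jE] : exists j, m = a + j.+1 by exists (m - a).-1; lia.
nia.
Qed.

Section CompleteBipartiteRecognition.
Variables (T : finType) (h : rel T) (k m : nat).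
Hypotheses (hsym : symmetric h) (k_gt0 : 0 < k) (lt_km : k < m).
Hypothesis cardT : #|T| = k + m + 1.
Hypothesis deg_hm : forall x, deg h x <= m.
Hypothesis deg_sum : forall x y, h x y -> k + m <= deg h x + deg h y.
Hypothesis deg_prod : forall x y, h x y -> deg h x * deg h y = k * m.

Let edge_deg x y : h x y ->
  (deg h x = k /\ deg h y = m) \/ (deg h x = m /\ deg h y = k).
Proof. by move=> hxy; apply: degrees_at_extremes; auto. Qed.

Let nbrs_k x y : deg h x = k -> h x y -> deg h y = m.
Proof. by move=> xk /edge_deg [[]|[]] //; lia. Qed.

Let nbrs_m x y : deg h x = m -> h x y -> deg h y = k.
Proof. by move=> xm /edge_deg [[]|[]] //; lia. Qed.

Let Dk := [set x | deg h x == k].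
Let Dm := [set x | deg h x == m].

(** Neighbours of degree-k vertices have degree m and conversely, so both sides count the edges of h
    between [Dk] and [Dm]. *)
Let double_count : k * #|Dk| = m * #|Dm|.
Proof.
have degS (D D' : {set T}) d : (forall x, x \in D -> deg h x = d) ->
    (forall x y, x \in D -> h x y -> y \in D') ->
    d * #|D| = \sum_(x in D) \sum_(y in D') h x y.
  move=> dD DD'; rewrite mulnC -sum_nat_const; apply: eq_bigr => x xD.
  rewrite -(dD x xD) /deg -sum1_card big_mkcond [RHS]big_mkcond.
  apply: eq_bigr => y _; rewrite inE.
  by case hxy: (h x y); [rewrite (DD' _ _ xD hxy)|case: ifP].
rewrite (degS Dk Dm); first rewrite (degS Dm Dk).
- rewrite exchange_big; apply: eq_bigr => y _; apply: eq_bigr => x _.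
  by rewrite hsym.
- by move=> x; rewrite inE => /eqP.
- by move=> x y; rewrite !inE => /eqP xm /(nbrs_m xm) ->.
- by move=> x; rewrite inE => /eqP.
- by move=> x y; rewrite !inE => /eqP xk /(nbrs_k xk) ->.
Qed.

(** An edge of h provides k vertices in [Dm] and m in [Dk]. At most one vertex is left over, and k
    #|Dk| = m #|Dm| with 0 < k < m keeps it out of both classes. Degrees then force all edges
    between them. *)
Lemma complete_bipartite_recognition x0 y0 : h x0 y0 ->
  exists A B : {set T}, [/\ #|A| = k, #|B| = m, [disjoint A & B] &
    forall x y, h x y = (x \in A) && (y \in B) || (x \in B) && (y \in A)].
Proof.
move=> hxy0.
have [x [y [hxy xk ym]]] : exists x y, [/\ h x y, deg h x = k & deg h y = m].
  case: (edge_deg hxy0) => -[xE yE]; first by exists x0, y0.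
  by exists y0, x0; rewrite hsym.
have dis : [disjoint Dm & Dk].
  rewrite disjoint_subset; apply/fintype.subsetP => z; rewrite !inE => /eqP ->.
  by rewrite gtn_eqF.
have le_kDm : k <= #|Dm|.
  rewrite -xk /deg -cardsE subset_leq_card //; apply/fintype.subsetP => z.
  by rewrite !inE => /(nbrs_k xk) ->.
have le_mDk : m <= #|Dk|.
  rewrite -ym /deg -cardsE subset_leq_card //; apply/fintype.subsetP => z.
  by rewrite !inE => /(nbrs_m ym) ->.
have le_n : #|Dm| + #|Dk| <= k + m + 1.
  have := (leq_card_setU Dm Dk).2; rewrite dis => /eqP <-.
  by rewrite -cardT max_card.
have [cDm cDk] : #|Dm| = k /\ #|Dk| = m by have := double_count; split; nia.
exists Dm, Dk; split=> // u v; apply/idP/orP => [huv|].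
  by case: (edge_deg huv) => -[du dv]; [right|left]; rewrite !inE du dv !eqxx.
have full a b : a \in Dm -> b \in Dk -> h a b.
  move=> aD bD; have sub : [set z | h a z] \subset Dk.
    apply/fintype.subsetP => z; rewrite !inE in aD *.
    by move/eqP: aD => /nbrs_m /[apply] ->.
  have : [set z | h a z] == Dk.
    rewrite eqEcard sub cDk cardsE; move: aD; rewrite inE => /eqP <-.
    exact: leqnn.
  by move/eqP/setP/(_ b); rewrite bD inE.
by case=> /andP [uD vD]; [|rewrite hsym]; exact: full.
Qed.

End CompleteBipartiteRecognition.

Lemma complete_ham (T : finType) (e : rel T) : symmetric e -> 2 < #|T| ->
  (forall u v, u != v -> e u v) -> ham_rel e.
Proof.
move=> esym T2 econ; have hs := complete_ham_path econ.
have us := enum_uniq T; have szs : size (enum T) = #|T| by rewrite cardE.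
have [d _] : exists d : T, true.
  by case: (enum T) szs T2 => [<-|d _ _] //; exists d.
have [T1 T0] : 1 < #|T| /\ 0 < #|T| by split; lia.
have last_lt : #|T|.-1 < #|T| by rewrite prednK.
apply: (@path_crossing _ e (enum T) d 0) => //; rewrite ?szs //.
  by rewrite -nth0; apply: econ; rewrite nth_uniq ?szs.
by rewrite -nth_last szs; apply: econ; rewrite nth_uniq ?szs //; lia.
Qed.

Lemma deg_compl (T : finType) (e : rel T) x : irreflexive e ->
  deg (fun x y => (x != y) && ~~ e x y) x + deg e x + 1 = #|T|.
Proof.
move=> eirr; have := cardC [pred y | e x y].
rewrite (cardD1 x [predC _]) !inE eirr /= => <-.
rewrite -/(deg e x) -addnA addnCA [_ + 1]addnC; congr (_ + (_ + _)).
by apply: eq_card => y; rewrite !inE eq_sym.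
Qed.

Lemma nbrs_fill (T : finType) (e : rel T) x (S : {set T}) :
  (forall y, e x y -> y \in S) -> #|S| <= deg e x -> forall y, e x y = (y \in S).
Proof.
move=> sub le_S y.
have : [set z | e x z] == S.
  rewrite eqEcard cardsE le_S andbT; apply/fintype.subsetP => z; rewrite inE.
  exact: sub.
by move/eqP/setP/(_ y); rewrite inE.
Qed.

Lemma outside_partition_eq (T : finType) (A B : {set T}) x y :
  [disjoint A & B] -> #|T| = #|A| + #|B| + 1 ->
  x \notin A -> x \notin B -> y \notin A -> y \notin B -> x = y.
Proof.
move=> dis TE xA xB yA yB.
have := (leq_card_setU A B).2; rewrite dis => /eqP cU.
have /eqP/cards1P [w /setP wE] : #|~: (A :|: B)| = 1.
  by have := cardsC (A :|: B); rewrite cU TE; lia.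
have := wE x; rewrite !inE negb_or xA xB /= => /esym/eqP ->.
by have := wE y; rewrite !inE negb_or yA yB /= => /esym/eqP ->.
Qed.

(** Covers both extremal graphs: vertices outside A and B are adjacent to all others, so G is
    [L_under] if there are none and [L] if there is exactly one. *)
Definition compl_bipartite (G : sgraph) (A B : {set G}) :=
  [disjoint A & B] /\ forall x y : G,
    compl_adj x y = (x \in A) && (y \in B) || (x \in B) && (y \in A).

(** A vertex of A cannot be adjacent to itself or to the k vertices of B; only k vertices remain,
    and the minimum degree makes all of them neighbours. The same holds for B. *)
Lemma half_degree_cliques (G : sgraph) k (A B : {set G}) :
  #|G| = 2 * k + 1 -> (forall x : G, k <= degree x) ->
  #|A| = k -> #|B| = k -> [disjoint A & B] ->
  (forall x y, x \in A -> y \in B -> ~~ adj x y) -> compl_bipartite A B.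
Proof.
move=> Gk degk Ak Bk dis nAB; split=> // x y.
have clique (C D : {set G}) u v : #|D| = k -> [disjoint C & D] ->
    (forall x y, x \in C -> y \in D -> ~~ adj x y) ->
    u \in C -> compl_adj u v -> v \in D.
  move=> Dk disCD nCD uC.
  have uD : u \notin D by rewrite (disjointFr disCD).
  have card_S : #|~: D :\ u| = k.
    have := cardsC D; rewrite (cardsD1 u (~: D)) inE uD Dk -[RHS]/#|G| Gk /=; lia.
  have nbrs := @nbrs_fill G (@adj G) u (~: D :\ u).
  rewrite /compl_adj nbrs ?card_S ?degk //; last first.
    move=> z uz; rewrite !inE; apply/andP; split.
      by apply: contraTneq uz => ->; rewrite adj_irrefl.
    by apply: contraL uz => /(nCD _ _ uC).
  by rewrite !inE negb_and !negbK eq_sym => /andP [/negPf ->].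
have nBA a b : a \in B -> b \in A -> ~~ adj a b.
  by move=> aB bA; rewrite adj_sym nAB.
have disBA : [disjoint B & A] by rewrite disjoint_sym.
have cAB u v := @clique A B u v Bk dis nAB.
have cBA u v := @clique B A u v Ak disBA nBA.
apply/idP/orP => [cxy|].
  have cyx : compl_adj y x by rewrite compl_adj_sym.
  have [xA|xA] := boolP (x \in A); first by left; rewrite (cAB x).
  have [xB|xB] := boolP (x \in B); first by right; rewrite (cBA x).
  have [yA|yA] := boolP (y \in A); first by case/negP: xB; apply: cAB cyx.
  have [yB|yB] := boolP (y \in B); first by case/negP: xA; apply: cBA cyx.
  have xy : x = y.
    by apply: outside_partition_eq dis _ xA xB yA yB; rewrite Ak Bk; lia.
  by move: cxy; rewrite /compl_adj xy eqxx.
have sub a b : a \in A -> b \in B -> compl_adj a b.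
  move=> aA bB; rewrite /compl_adj nAB // andbT.
  by apply: contraTneq bB => <-; rewrite (disjointFr dis).
by case=> /andP [xC yC]; [|rewrite compl_adj_sym]; exact: sub.
Qed.

(** Here a b - k m >= (a - k)(m - a) >= 0. *)
Lemma leq_mul_of_sum k m a b : a <= m -> b <= m -> k + m <= a + b ->
  k * m <= a * b.
Proof.
move=> am bm; have [i iE] : exists i, m = a + i by exists (m - a); lia.
have [j jE] : exists j, m = b + j by exists (m - b); lia.
move=> ab; have kE : k + i <= b by lia.
have kE' : k + j <= a by lia.
by rewrite iE; nia.
Qed.

(** Common core of both parts, to be applied to G and to the cone over G. The hypothesis bounds
    eigenvalues by the spectral radius of K_{k,n-k-1}, so that no particular extremal graph is
    mentioned. *)
Lemma hamiltonian_or_extremal (R : realType) (G : sgraph) k :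
  0 < k -> 2 * k + 1 <= #|G| -> (forall x : G, k <= degree x) ->
  (forall a : R, eigenvalue (adjacency R (gcompl G)) a ->
     (a <= Num.sqrt (k * (#|G| - k - 1))%:R)%R) ->
  [\/ hamiltonian G,
      exists A B : {set G},
        [/\ #|A| = k, #|B| = #|G| - k - 1 & compl_bipartite A B] |
      #|G| = 2 * k + 1 /\ exists2 I : {set G}, #|I| = k.+1 &
        forall x y, x \in I -> adj x y = (y \notin I)].
Proof.
move=> k0 Gk degk le_r; have T2 : 2 < #|G| by lia.
have [ham|nham] := pselect (hamiltonian G); first by constructor 1.
have [e [esym eirr sub nhame sat]] :=
  ham_saturation (@adj_sym G) (@adj_irrefl G) nham.
have degek x : k <= deg e x.
  apply: leq_trans (degk x) _; rewrite /degree /deg subset_leq_card //.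
  by apply/fintype.subsetP => y; rewrite !inE; exact: sub.
have nsub x y : ~~ e x y -> ~~ adj x y by apply: contra; exact: sub.
have [GE|Gneq] := eqVneq #|G| (2 * k + 1).
  have [s hs] := saturated_ham_path sat.
  have [[I cI indI]|[A [B [cA cB dis nAB]]]] :=
    half_degree_ham_path esym eirr k0 GE degek nhame hs.
    constructor 3; split=> //; exists I => // x y xI.
    (* Only the k vertices outside I can be neighbours of x, and the minimum degree requires all of
       them. *)
    rewrite -finset.in_setC; apply: nbrs_fill => [z|].
      rewrite inE; apply: contraTN => zI; apply: nsub; exact: indI.
    have := cardsC I; rewrite cI -[RHS]/#|G| GE => cIC.
    by apply: leq_trans (degk x); lia.
  constructor 2; exists A, B; split=> //; first by rewrite cB GE; lia.
  by apply: half_degree_cliques GE degk cA cB dis _ => x y xA /(nAB x y xA) /nsub.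
have lt_km : k < #|G| - k - 1 by lia.
set m := #|G| - k - 1 in lt_km le_r *.
have GE : #|G| = k + m + 1 by rewrite /m; lia.
pose h : rel G := fun x y => (x != y) && ~~ e x y.
have hsym : symmetric h by move=> x y; rewrite /h eq_sym esym.
have hcompl : subrel h (@adj (gcompl G)).
  by move=> x y /andP [xy /nsub nxy]; rewrite /= /compl_adj xy.
have deghE x : deg h x + deg e x + 1 = k + m + 1 by rewrite -GE deg_compl.
have deg_hm x : deg h x <= m.
  by have := deghE x; have := degek x; lia.
have hsum x y : h x y -> k + m <= deg h x + deg h y.
  case/andP => xy nxy; have := saturated_ore esym eirr T2 nhame sat xy nxy.
  by rewrite GE; have := deghE x; have := deghE y; lia.
have km0 : 0 < k * m by rewrite muln_gt0 k0; lia.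
have hprod x y : h x y -> k * m <= deg h x * deg h y.
  by move=> hxy; apply: leq_mul_of_sum => //; exact: hsum.
have [x0 [y0 hxy0]] : exists x y, h x y.
  apply: contra_notP nhame => nh; apply: complete_ham => // u v uv.
  by apply/negPn/negP => nuv; apply: nh; exists u, v; apply/andP.
have [A [B [cA cB dis hE]]] := complete_bipartite_recognition hsym k0 lt_km GE
  deg_hm hsum (@subgraph_degree_product R (gcompl G) h _ hcompl le_r hprod) hxy0.
constructor 2; exists A, B; split=> //; split=> // x y; rewrite -hE.
(* An edge of the complement of G outside h would join two distinct vertices isolated in h, but only
   one vertex lies outside A and B. *)
apply/idP/idP => [cxy|]; last exact: hcompl.
apply: contraT => nhxy.
have [x_0 y_0] := @non_subgraph_edge_isolated R (gcompl G) h _ km0 hcompl le_r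
  hprod x y cxy nhxy.
have [a aA] : exists a, a \in A by apply/card_gt0P; rewrite cA.
have [b bB] : exists b, b \in B by apply/card_gt0P; rewrite cB; lia.
have isolated z : deg h z = 0 -> (z \notin A) /\ (z \notin B).
  move=> /card0_eq z0; split; apply/negP => zC.
    by have := z0 b; rewrite inE hE zC bB.
  by have := z0 a; rewrite inE hE zC aA orbT.
have [[xA xB] [yA yB]] := (isolated x x_0, isolated y y_0).
have xy : x = y by apply: outside_partition_eq dis _ xA xB yA yB; rewrite cA cB.
by move: cxy; rewrite /compl_adj xy eqxx.
Qed.

(** * Isomorphism with the extremal graphs *)

Lemma set_parametrization (T : finType) (A : {set T}) k : #|A| = k ->
  exists2 f : 'I_k -> T, injective f & forall i, f i \in A.
Proof.
move=> <-; exists enum_val; first exact: enum_val_inj.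
by move=> i; exact: enum_valP.
Qed.

(** The model graphs live on sum types, where maps into G are defined by cases; the isomorphism
    required is the inverse of such a map. *)
Lemma iso_of_inj (G H : sgraph) (g : H -> G) : injective g -> #|G| <= #|H| ->
  (forall x y, adj (g x) (g y) = adj x y) -> iso G H.
Proof.
move=> gI GH gadj; have [f gK fK] := inj_card_bij gI GH.
by exists f => [|x y]; [exists g | rewrite -gadj !fK].
Qed.

Lemma spanning_subgraph_of_inj (G H : sgraph) (g : H -> G) :
  injective g -> #|G| <= #|H| ->
  (forall x y, adj (g x) (g y) -> adj x y) -> spanning_subgraph G H.
Proof.
move=> gI GH gadj; have [f gK fK] := inj_card_bij gI GH.
by exists f => [|x y xy]; [exists g | apply: gadj; rewrite !fK].
Qed.

Section SumParametrization.
Variables (T : finType) (A B : {set T}) (U V : Type) (f : U -> T) (g : V -> T).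
Hypotheses (fI : injective f) (gI : injective g) (dis : [disjoint A & B]).
Hypotheses (fA : forall u, f u \in A) (gB : forall v, g v \in B).

Definition sum_fun (x : U + V) : T :=
  match x with inl u => f u | inr v => g v end.

Lemma sum_fun_inj : injective sum_fun.
Proof.
have ne u v : f u <> g v.
  by move=> fg; have := gB v; rewrite -fg (disjointFr dis).
case=> [u|v] [u'|v'] /=; first by move/fI ->.
- by move/ne.
- by move/esym/ne.
by move/gI ->.
Qed.

End SumParametrization.

Lemma adj_compl (G : sgraph) (x y : G) :
  adj x y = (x != y) && ~~ compl_adj x y.
Proof.
rewrite /compl_adj negb_and !negbK; case: eqVneq => [->|] //=.
exact: adj_irrefl.
Qed.

Section ComplBipartiteIso.
Variables (G : sgraph) (p q : nat) (A B : {set G}).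
Hypotheses (cA : #|A| = p) (cB : #|B| = q) (AB : compl_bipartite A B).

Let dis : [disjoint A & B]. Proof. by case: AB. Qed.
Let complE (x y : G) : compl_adj x y =
  (x \in A) && (y \in B) || (x \in B) && (y \in A).
Proof. by case: AB. Qed.

(** A and B are cliques of G without edges between them. The location of the image is recorded so
    that a leftover vertex can be kept apart from it. *)
Lemma compl_bipartite_param : exists2 g : gunion (complete p) (complete q) -> G,
  injective g & [/\ forall x y, adj (g x) (g y) = adj x y &
    forall x, (g x \in A) || (g x \in B)].
Proof.
have [f fI fA] := set_parametrization cA.
have [g gI gB] := set_parametrization cB.
exists (sum_fun f g); first exact: sum_fun_inj fI gI dis fA gB.
have fB i : (f i \in B) = false by rewrite (disjointFr dis).
have gA j : (g j \in A) = false by rewrite (disjointFl dis).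
split=> [|[i|j]] /=; rewrite ?fA ?gB ?orbT //.
case=> [i|j] [i'|j'] /=; rewrite adj_compl complE ?fA ?gB ?fB ?gA ?andbF //=.
- by rewrite andbT (inj_eq fI).
- by rewrite andbT (inj_eq gI).
Qed.

Lemma iso_union_complete : #|G| = p + q ->
  iso G (gunion (complete p) (complete q)).
Proof.
move=> GE; have [g gI [gadj _]] := compl_bipartite_param.
by apply: (iso_of_inj gI _ gadj); rewrite card_sum !card_ord GE.
Qed.

Lemma iso_join_union_complete : #|G| = p + q + 1 ->
  iso G (gjoin (complete 1) (gunion (complete p) (complete q))).
Proof.
move=> GE; have [g gI [gadj gAB]] := compl_bipartite_param.
have [w wAB] : exists w, w \notin A :|: B.
  have := (leq_card_setU A B).2; rewrite dis => /eqP cU.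
  have /card_gt0P [w] : 0 < #|~: (A :|: B)|.
    by have := cardsC (A :|: B); rewrite cU cA cB -[RHS]/#|G| GE; lia.
  by rewrite finset.in_setC => wAB; exists w.
have [wA wB] : (w \in A = false) /\ (w \in B = false).
  by move: wAB; rewrite !inE negb_or => /andP [/negPf -> /negPf ->].
have wg x : w != g x.
  by apply: contraTneq (gAB x) => <-; rewrite wA wB.
apply: (@iso_of_inj G (gjoin (complete 1) (gunion (complete p) (complete q)))
  (sum_fun (fun=> w) g)).
- case=> [i|x] [j|y] //=; first by rewrite (ord1 i) (ord1 j).
  + by move/eqP; rewrite (negPf (wg y)).
  + by move/esym/eqP; rewrite (negPf (wg x)).
  by move/gI ->.
- by rewrite !card_sum !card_ord GE addnC.
case=> [i|x] [j|y] /=; last exact: gadj.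
- by rewrite adj_irrefl /complete_adj !ord1 eqxx.
- by rewrite adj_compl complE wA wB wg.
- by rewrite adj_sym adj_compl complE wA wB wg.
Qed.

End ComplBipartiteIso.

(** The edges between I and its complement give the lower inclusion of the class, and the
    independence of I the upper one. *)
Lemma independent_join_class_H (G : sgraph) n (I : {set G}) :
  #|G| = n -> (uphalf n).-1 + #|I| = n -> #|I| = n./2.+1 ->
  (forall x y, x \in I -> adj x y = (y \notin I)) -> class_H n G.
Proof.
move=> Gn cIn cI adjI.
have cC : #|~: I| = (uphalf n).-1 by have := cardsC I; rewrite -[RHS]/#|G| Gn; lia.
have [f fI fC] := set_parametrization cC.
have [g gI gI'] := set_parametrization cI.
have fnI i : f i \notin I by have := fC i; rewrite inE.
have dis : [disjoint ~: I & I] by rewrite finset.disjoints_subset.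
split=> //.
  exists (sum_fun f g).
    apply: inj_card_bij; first exact: sum_fun_inj fI gI dis fC gI'.
    by rewrite card_sum !card_ord Gn -cI cIn.
  case=> [i|i] [j|j] //= _; last by rewrite adjI.
  by rewrite adj_sym adjI.
apply: (@spanning_subgraph_of_inj G
  (gjoin (complete (uphalf n).-1) (copies n./2.+1 (complete 1)))
  (sum_fun f (g \o fst))).
- apply: sum_fun_inj fI _ dis fC _ => [[i u] [j v] /= /gI ->|x]; last exact: gI'.
  by rewrite (ord1 u) (ord1 v).
- by rewrite card_sum card_prod !card_ord muln1 Gn -cI cIn.
case=> [i|[i u]] [j|[j v]] //=.
  by apply: contraTneq => ->; rewrite adj_irrefl.
by rewrite adjI // gI'.
Qed.

(** * From the cone over G back to G *)

Section ConeTransfer.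
Variable G : sgraph.
Let G1 := gjoin (complete 1) G.

Let inrI : injective (inr : G -> G1). Proof. by move=> x y []. Qed.

Lemma card_cone : #|G1| = #|G|.+1.
Proof. by rewrite card_sum card_ord. Qed.

Lemma degree_cone_base (x : G) : degree (inr x : G1) = (degree x).+1.
Proof.
rewrite /degree -!sum1_card big_sumType /= -[RHS]add1n; congr (_ + _).
by rewrite big_mkcond big_ord1.
Qed.

Lemma degree_cone_apex (i : 'I_1) : degree (inl i : G1) = #|G|.
Proof.
rewrite /degree -!sum1_card big_sumType /= big_pred0 ?add0n // => j.
by rewrite !inE /= /complete_adj !ord1 eqxx.
Qed.

(** Deleting the apex from the cycle leaves a Hamiltonian path of G. *)
Lemma hamiltonian_cone_traceable : hamiltonian G1 -> traceable G.
Proof.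
case=> c [/andP [cc uc] c2 mc].
have [i q cE] := rot_to (mc (inl ord0)).
have uq : uniq (inl ord0 :: q) by rewrite -cE rot_uniq.
have cq : cycle (@adj G1) (inl ord0 :: q) by rewrite -cE rot_cycle.
have [p qE] : exists p, q = map inr p.
  case/andP: uq => nq _; elim: q nq {cE cq} => [|[j|x] q IHq]; first by exists [::].
    by rewrite (ord1 j) mem_head.
  by rewrite inE => /IHq [p ->]; exists (x :: p).
have sq : 1 < size q by have := c2; rewrite -(size_rot i) cE.
rewrite qE in cE uq cq sq *.
case: p cE uq cq sq {qE} => // x p cE /andP [_ uq] cq _.
exists x, p; split.
- by move: cq; rewrite /= rcons_path path_map => /andP [].
- by rewrite -(map_inj_uniq inrI).
move=> y; have : (inr y : G1) \in inl ord0 :: map inr (x :: p).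
  by rewrite -cE mem_rot.
by rewrite in_cons (mem_map inrI).
Qed.

Lemma card_cone_preim (A : {set G1}) : inl ord0 \notin A ->
  #|[set x | inr x \in A]| = #|A|.
Proof.
move=> nA; rewrite -(card_imset _ inrI); apply: eq_card => -[i|x].
  by rewrite (ord1 i) (negPf nA); apply/imsetP => -[].
by rewrite (mem_imset _ _ inrI) inE.
Qed.

(** The apex is isolated in the complement, while each vertex of one side has a neighbour in the
    other, nonempty side; so the apex lies in neither. *)
Lemma compl_bipartite_cone (A B : {set G1}) : 0 < #|A| -> 0 < #|B| ->
  compl_bipartite A B ->
  [/\ #|[set x | inr x \in A]| = #|A|, #|[set x | inr x \in B]| = #|B| &
      compl_bipartite [set x : G | inr x \in A] [set x | inr x \in B]].
Proof.
move=> /card_gt0P [a aA] /card_gt0P [b bB] [dis AB].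
have apex (z : G1) : compl_adj (inl ord0 : G1) z = false.
  by case: z => [j|y]; rewrite /compl_adj ?andbF //= (ord1 j) eqxx.
split.
- apply: card_cone_preim; apply/negP => wA.
  by have := AB (inl ord0) b; rewrite apex wA bB.
- apply: card_cone_preim; apply/negP => wB.
  by have := AB (inl ord0) a; rewrite apex wB aA orbT.
split=> [|x y]; last by rewrite !inE -AB.
rewrite disjoint_subset; apply/fintype.subsetP => x; rewrite !inE => xA.
by rewrite (disjointFr dis).
Qed.

(** The apex is adjacent to every other vertex, so it is in no independent set with two elements. *)
Lemma independent_join_cone (I : {set G1}) : 1 < #|I| ->
  (forall x y, x \in I -> adj x y = (y \notin I)) ->
  #|[set x | inr x \in I]| = #|I| /\
  forall x y : G, x \in [set x | inr x \in I] ->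
    adj x y = (y \notin [set x | inr x \in I]).
Proof.
move=> I2 adjI; split; last by move=> x y; rewrite !inE => /adjI <-.
apply: card_cone_preim; apply/negP => wI.
move: I2; rewrite (cardsD1 (inl ord0)) wI ltnS => /card_gt0P [[j|x]].
  by rewrite !inE (ord1 j) eqxx.
by rewrite !inE /= => xI; have := adjI _ (inr x) wI; rewrite xI.
Qed.

End ConeTransfer.

Lemma min_degree_le (G : sgraph) (x : G) : min_degree G <= degree x.
Proof.
rewrite /min_degree; have : x \in index_enum G by rewrite mem_index_enum.
elim: (index_enum G) => // y r IHr; rewrite inE big_cons geq_min.
by case/orP => [/eqP <-|/IHr ->]; rewrite ?leqnn ?orbT.
Qed.

Theorem theorem1p6 (R : realType) (k n : nat) (G : sgraph) (Gn : #|G| = n) :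
  ((0 <= k <= min_degree G)%N ->
   (2 * k + 2 <= n)%N ->
   (spectral_radius R (gcompl G) <= spectral_radius R (gcompl (L_under n k)))%R ->
   traceable G \/ (iso G (L_under n k) \/ (n = 2 * k + 2 /\ class_H n G)))
  /\
  ((1 <= k <= min_degree G)%N ->
   (2 * k + 1 <= n)%N ->
   (spectral_radius R (gcompl G) <= spectral_radius R (gcompl (L n k)))%R ->
   hamiltonian G \/ (iso G (L n k) \/ (n = 2 * k + 1 /\ class_H n G))).
Proof.
split=> [/andP [_ le_k] | /andP [k0 le_k]] kn rho.
  have degk (x : gjoin (complete 1) G) : k.+1 <= degree x.
    case: x => [i|x]; first by rewrite degree_cone_apex Gn; lia.
    by rewrite degree_cone_base ltnS (leq_trans le_k) // min_degree_le.
  have cG1 : #|gjoin (complete 1) G| = n.+1 by rewrite card_cone Gn.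
  have le_n : 2 * k.+1 + 1 <= #|gjoin (complete 1) G| by rewrite cG1; lia.
  have [|ham|[A [B [cA cB AB]]]|[GE [I cI adjI]]] :=
    @hamiltonian_or_extremal R (gjoin (complete 1) G) k.+1 isT le_n degk.
  (* In the complement the apex can only bring the eigenvalue 0. Since (n + 1) - (k + 1) - 1 = n - k
     - 1, the bound required is the one for the complement K_{k+1,n-k-1} of [L_under n k]. *)
  - move=> a /eigenvalue_compl_join1 [->|aG]; first exact: sqrtr_ge0.
    rewrite cG1 subSS (le_trans (eigenvalue_le_spectral_radius aG)) //.
    apply: le_trans rho (spectral_radius_le (sqrtr_ge0 _) _) => b.
    exact: eigenvalue_compl_union_complete.
  - by left; exact: hamiltonian_cone_traceable.
  - right; left; rewrite cG1 subSS in cB.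
    have [||cA' cB' AB'] := compl_bipartite_cone _ _ AB.
    + by rewrite cA.
    + by rewrite cB; lia.
    rewrite cA in cA'; rewrite cB in cB'.
    by apply: iso_union_complete cA' cB' AB' _; rewrite Gn; lia.
  right; right; rewrite cG1 in GE.
  have nE : n = 2 * k + 2 by lia.
  split=> //; have [|cI' adjI'] := independent_join_cone _ adjI; first by rewrite cI.
  (* For n = 2k + 2, ceil(n/2) - 1 = k and floor(n/2) + 1 = k + 2, the size of I obtained from k +
     1. *)
  by apply: independent_join_class_H Gn _ _ adjI'; rewrite cI' cI; lia.
have degk (x : G) : k <= degree x by rewrite (leq_trans le_k) // min_degree_le.
have le_n : 2 * k + 1 <= #|G| by rewrite Gn.
have [|ham|[A [B [cA cB AB]]]|[GE [I cI adjI]]] :=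
  @hamiltonian_or_extremal R G k k0 le_n degk.
- move=> a aG; apply: le_trans (eigenvalue_le_spectral_radius aG) _.
  apply: le_trans rho (spectral_radius_le (sqrtr_ge0 _) _) => b.
  (* The complement of [L n k] is K_{k,n-k-1} with an isolated vertex. *)
  case/eigenvalue_compl_join1 => [->|]; first exact: sqrtr_ge0.
  by rewrite Gn; exact: eigenvalue_compl_union_complete.
- by left.
- right; left; rewrite Gn in cB.
  by apply: iso_join_union_complete cA cB AB _; rewrite Gn; lia.
right; right; rewrite Gn in GE; split=> //.
by apply: independent_join_class_H Gn _ _ adjI; rewrite cI; lia.
Qed.
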